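(* Let $\mu$ be a nontrivial probability measure supported on an infinite subset $I$ of the real line with finite moments of all nonnegative orders. Let $h$ be a monic polynomial of degree $N$ with real coefficients, with distinct zeros $\alpha_1,\dots,\alpha_p$ of multiplicities $\beta_1,\dots,\beta_p$ ($\sum_{i=1}^p\beta_i=N$), and consider the measure $d\mu_0=h\,d\mu$. Let $[\cdot,\cdot]_h$ be a symmetric bilinear form on the space $\mathbb{P}$ of real polynomials such that $$[hf,g]_h=[f,hg]_h=\int_I f(t)g(t)\,d\mu_0(t)\qquad\text{for all } f,g\in\mathbb{P},$$ and put $s_{i,j}=[t^i,t^j]_h$ for $0\le i,j\le N-1$. Then for all polynomials $f,g\in\mathbb{P}$, $$[f,g]_h=\int_I f(t)g(t)\,d\mu+\begin{bmatrix}F_1^T&\cdots&F_p^T\end{bmatrix}\mathcal{A}^{-T}S\mathcal{A}^{-1}\begin{bmatrix}G_1\\ \vdots\\ G_p\end{bmatrix},$$ where $F_i=[f(\alpha_i),\dots,f^{(\beta_i-1)}(\alpha_i)]^T$, $G_i=[g(\alpha_i),\dots,g^{(\beta_i-1)}(\alpha_i)]^T$, and $S$ is the symmetric $N\times N$ matrix with entries $$S_{i,j}=s_{i,j}-\int_I t^{i+j}\,d\mu,\qquad 0\le i,j\le N-1.$$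
   Context: A measure is nontrivial if its support is infinite. $\mathcal{A}$ is the (nonsingular) $N\times N$ matrix obtained by stacking $A_1,\dots,A_p$ vertically, where $A_i$ is the $\beta_i\times N$ matrix whose entry in row $j$ ($0\le j\le\beta_i-1$) and column $k$ ($0\le k\le N-1$) is $\frac{k!}{(k-j)!}\alpha_i^{k-j}$ if $k\ge j$ and $0$ if $k<j$ (i.e. the $j$-th derivative of $t^k$ at $\alpha_i$). $\mathcal{A}^{-T}$ denotes the transpose of $\mathcal{A}^{-1}$. *)

(* Defs.v *)
From HB Require Import structures.
From mathcomp Require Import all_boot all_order all_algebra.
From mathcomp Require Import all_classical all_reals all_analysis.
From mathcomp Require Import complex.

Set Implicit Arguments.
Unset Strict Implicit.
Unset Printing Implicit Defensive.

Import Order.TTheory GRing.Theory Num.Theory.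
Import numFieldNormedType.Exports.

Local Open Scope classical_set_scope.
Local Open Scope ring_scope.
Local Open Scope complex_scope.

Definition msupport (R : realType)
    (mu : {measure set (measurableTypeR R) -> \bar R}) : set R :=
  [set x | forall U : set R, open U -> U x -> (0 < mu U)%E].

Definition nontrivial_measure (R : realType)
    (mu : {measure set (measurableTypeR R) -> \bar R}) : Prop :=
  infinite_set (msupport mu).

Definition polyC_of (R : realType) (f : {poly R}) : {poly R[i]} :=
  map_poly (real_complex R) f.

(* \int_I phi dmu0 for the measure dmu0 = h dmu, which is signed in general
   because h may change sign on I. *)
Definition density_int (R : realType)
    (mu : {measure set (measurableTypeR R) -> \bar R}) (I : set R)
    (h : {poly R}) (phi : R -> R) : R :=
  \int[mu]_(t in I) (phi t * h.[t]).

Section Confluent.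
Variables (R : realType) (p : nat) (beta : 'I_p -> nat) (alpha : 'I_p -> R[i]).

Definition confluent_block (N : nat) (i : 'I_p) : 'M[R[i]]_(beta i, N) :=
  \matrix_(j < beta i, k < N)
    (if (j <= k)%N then k`!%:R / ((k - j)%N)`!%:R * alpha i ^+ (k - j)%N else 0).

(* N is written as the sum of the multiplicities, so that the stacked matrix
   is square definitionally. *)
Definition confluent_mx : 'M[R[i]]_(\sum_(i < p) beta i) :=
  \mxcol_(i < p) confluent_block (\sum_(i < p) beta i) i.

Definition jet_block (f : {poly R}) (i : 'I_p) : 'cV[R[i]]_(beta i) :=
  \col_(j < beta i) ((polyC_of f)^`(j)).[alpha i].

Definition jet_col (f : {poly R}) : 'cV[R[i]]_(\sum_(i < p) beta i) :=
  \mxcol_(i < p) jet_block f i.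

Definition jet_row (f : {poly R}) : 'rV[R[i]]_(\sum_(i < p) beta i) :=
  \mxrow_(i < p) (jet_block f i)^T.

End Confluent.

Definition moment_defect_mx (R : realType)
    (mu : {measure set (measurableTypeR R) -> \bar R}) (I : set R)
    (form : {poly R} -> {poly R} -> R) (N : nat) : 'M[R]_N :=
  \matrix_(i < N, j < N) (form 'X^i 'X^j - \int[mu]_(t in I) t ^+ (i + j)%N).

(* Main.v *)
Require Import Defs.
From HB Require Import structures.
From mathcomp Require Import all_boot all_order all_algebra.
From mathcomp Require Import all_classical all_reals all_analysis.
From mathcomp Require Import complex.
From mathcomp Require Import ring.

Import Order.TTheory GRing.Theory Num.Theory.
Import numFieldNormedType.Exports.

Local Open Scope classical_set_scope.
Local Open Scope ring_scope.
Local Open Scope complex_scope.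

(** Consider the defect form B(f, g) = form f g - \int f g dmu.  By
    hypothesis form (h f) g is the integral of f g against h dmu, that is, the
    integral of (h f) g against dmu, and likewise in the second argument: every
    multiple of h lies in the radical of B, on either side.  Hence B(f, g)
    depends only on the remainders f %% h and g %% h ([form_defect_modp]), which
    have degree less than N, so B(f, g) is obtained by pairing their coefficient
    vectors through the Gram matrix S of B on the monomials
    ([form_defect_coef]).

    It remains to read off the coefficients of f %% h from the jets of f.
    A root of multiplicity b of h kills the derivatives of order less than b of
    every multiple of h, so f and f %% h have the same jets at the roots
    ([jet_col_modp]).  On polynomials of degree less than N, taking jets is the
    linear map whose matrix in the monomial basis is the confluent Vandermonde
    matrix ([jet_col_coef]), and this map is injective: a polynomial with
    vanishing jets is divisible by the product of the ('X - alpha_i) ^ beta_i,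
    of degree N ([confluent_mx_unit]).  The inverse matrix therefore sends the
    jets of f to the coefficients of f %% h, which is
    [invmx_confluent_jet_col]. *)

(** * Vanishing jets and divisibility *)

Section JetDivisibility.
Variable F : numFieldType.

(** One formula for both directions of the equivalence between divisibility by
    ('X - a) ^ m and vanishing of the first m derivatives at a: below order m
    the derivatives vanish, and the one of order m detects whether the cofactor
    q vanishes at a. *)
Lemma horner_derivn_exp_XsubC_mul (a : F) (q : {poly F}) (m j : nat) :
  (j <= m)%N ->
  (('X - a%:P) ^+ m * q)^`(j).[a] = (j == m)%:R * m`!%:R * q.[a].
Proof.
elim: m j q => [|m IH] [|j] // q le_jm.
- by rewrite derivn0 expr0 mul1r fact0 !mul1r.
- by rewrite derivn0 exprS -mulrA hornerM hornerXsubC subrr !mul0r.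
have dE : (('X - a%:P) ^+ m.+1 * q)^`() =
    ('X - a%:P) ^+ m * (q *+ m.+1 + ('X - a%:P) * q^`()).
  rewrite derivM deriv_exp derivXsubC mul1r /= mulrDr mulrnAl mulrnAr mulrA.
  by rewrite exprSr.
rewrite derivSn dE IH // hornerD hornerMn hornerM hornerXsubC subrr mul0r addr0.
by rewrite eqSS factS [in RHS]natrM mulrnAr -mulr_natl; ring.
Qed.

(** Characteristic zero matters here: once ('X - a) ^ m is known to divide q,
    the m-th derivative at a is m! times the value of the cofactor, and m! has
    to be cancelled to extract one more factor. *)
Lemma dvdp_exp_XsubC_derivn (a : F) (q : {poly F}) (m : nat) :
  (forall j, (j < m)%N -> q^`(j).[a] = 0) -> ('X - a%:P) ^+ m %| q.
Proof.
elim: m => [|m IH] vanish; first by rewrite expr0 dvd1p.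
have /dvdpP[r Dq] : ('X - a%:P) ^+ m %| q.
  by apply: IH => j lt_jm; apply/vanish/ltnW.
have /eqP := vanish m (ltnSn m).
rewrite Dq mulrC horner_derivn_exp_XsubC_mul // eqxx mul1r mulf_eq0.
rewrite pnatr_eq0 gtn_eqF ?fact_gt0 //= -/(root r a) -dvdp_XsubCl => r_root.
by rewrite exprSr dvdp_mul2l // expf_neq0 ?polyXsubC_eq0.
Qed.

Lemma dvdp_horner_derivn_eq0 (a : F) (q : {poly F}) (m j : nat) :
  ('X - a%:P) ^+ m %| q -> (j < m)%N -> q^`(j).[a] = 0.
Proof.
case/dvdpP=> r -> lt_jm; rewrite mulrC horner_derivn_exp_XsubC_mul 1?ltnW //.
by rewrite ltn_eqF // !mul0r.
Qed.

Lemma prod_exp_XsubC_dvdp (J : finType) (a : J -> F) (m : J -> nat)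
    (q : {poly F}) :
  injective a -> (forall i, ('X - (a i)%:P) ^+ m i %| q) ->
  \prod_i ('X - (a i)%:P) ^+ m i %| q.
Proof.
move=> a_inj dvd_q; elim: (index_enum J) (index_enum_uniq J) => [|i s IH].
  by rewrite big_nil dvd1p.
case/andP=> i_notin s_uniq; rewrite big_cons Gauss_dvdp ?dvd_q ?IH //.
rewrite big_seq; apply: coprimep_expl.
elim/big_ind: _ => [|u v cop_u cop_v|k k_s]; first exact: coprimep1.
  by rewrite coprimepMr cop_u.
apply: coprimep_expr; apply: coprimep_XsubC2; rewrite subr_eq0.
by apply: contraNneq i_notin => /a_inj <-.
Qed.

End JetDivisibility.

(** * The confluent Vandermonde system *)

Lemma poly_sum_coef_wide {R : nzRingType} {n : nat} {q : {poly R}} :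
  (size q <= n)%N -> q = \sum_(k < n) q`_k *: 'X^k.
Proof.
move=> size_q; rewrite -poly_def; apply/polyP => k; rewrite coef_poly.
by case: ltnP => // /(leq_trans size_q) /leq_sizeP ->.
Qed.

Section ConfluentSystem.
Variables (R : realType) (p : nat) (beta : 'I_p -> nat) (alpha : 'I_p -> R[i]).
Local Notation N := (\sum_(i < p) beta i)%N.

Lemma confluent_mx_coef (q : {poly R[i]}) :
  (size q <= N)%N ->
  confluent_mx beta alpha *m (poly_rV q)^T =
    \mxcol_(i < p) \col_(j < beta i) (q^`(j)).[alpha i].
Proof.
move=> size_q; apply/mxcolP => i; rewrite -submxcol_mul !mxcolK.
apply/matrixP => j ?; rewrite !mxE.
rewrite [in RHS](poly_sum_coef_wide size_q) linear_sum /= horner_sum.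
apply: eq_bigr => k _.
rewrite !mxE derivnZ derivnXn hornerZ hornerMn hornerXn mulrC; congr (_ * _).
case: leqP => [le_jk|lt_kj]; last by rewrite ffact_small // mulr0n.
have fact_neq0 : ((k - j)`!%:R : R[i]) != 0.
  by rewrite pnatr_eq0 gtn_eqF ?fact_gt0.
by rewrite -(ffact_fact le_jk) natrM mulfK // mulr_natl.
Qed.

Lemma jet_col_coef (f : {poly R}) :
  (size f <= N)%N ->
  jet_col beta alpha f =
    confluent_mx beta alpha *m (map_mx (real_complex R) (poly_rV f))^T.
Proof.
move=> size_f.
have -> : map_mx (real_complex R) (poly_rV f) = poly_rV (polyC_of f) :> 'rV_N.
  by apply/rowP => k; rewrite !mxE coef_map.
by rewrite confluent_mx_coef // size_map_poly.
Qed.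

(** This is unique solvability of Hermite interpolation: a kernel vector is a
    polynomial of degree less than N that has N zeros counted with
    multiplicity. *)
Lemma confluent_mx_unit :
  injective alpha -> confluent_mx beta alpha \in unitmx.
Proof.
move=> alpha_inj; rewrite -unitmx_tr -row_free_unit; apply: inj_row_free => v.
move/(congr1 trmx); rewrite trmx_mul trmxK trmx0 => Av0.
pose q := rVpoly v; have size_q : (size q <= N)%N by exact: size_poly.
have vE : v = poly_rV q by rewrite rVpolyK.
have jets0 i j : (j < beta i)%N -> q^`(j).[alpha i] = 0.
  move=> lt_j; move: Av0; rewrite vE confluent_mx_coef //.
  move/(congr1 (fun B => submxcol B i)); rewrite mxcolK submxcol0.
  by move/matrixP/(_ (Ordinal lt_j) ord0); rewrite !mxE.
have dvd_q : \prod_i ('X - (alpha i)%:P) ^+ beta i %| q.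
  apply: prod_exp_XsubC_dvdp => // i; apply: dvdp_exp_XsubC_derivn => j.
  exact: jets0.
suff q0 : q = 0 by rewrite vE q0 linear0.
have size_prod_exp : size (\prod_i ('X - (alpha i)%:P) ^+ beta i) = N.+1.
  rewrite size_prod => [|i _]; last by rewrite expf_neq0 ?polyXsubC_eq0.
  rewrite (eq_bigr (fun i => beta i + 1)%N) => [|i _].
    by rewrite big_split /= sum1_card -addSn addnK.
  by rewrite size_exp_XsubC addn1.
apply/eqP; apply: contraTT size_q => q_neq0; rewrite -ltnNge -size_prod_exp.
exact: dvdp_leq.
Qed.

(** The quotient part of the division contributes a multiple of h, whose jets
    vanish up to the multiplicities of the roots. *)
Lemma jet_col_modp (h f : {poly R}) :
  (forall i, ('X - (alpha i)%:P) ^+ beta i %| polyC_of h) ->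
  jet_col beta alpha (f %% h) = jet_col beta alpha f.
Proof.
move=> dvd_h; apply: eq_mxcol => i; apply/colP => j; rewrite !mxE.
rewrite [in RHS](divp_eq f h) /polyC_of [in RHS]rmorphD rmorphM /=.
rewrite derivnD hornerD [X in X + _](@dvdp_horner_derivn_eq0 _ _ _ (beta i)) //.
  by rewrite add0r.
exact/dvdp_mull/dvd_h.
Qed.

(** Hermite interpolation of the jets of f at the zeros of h returns the
    remainder of f modulo h. *)
Lemma invmx_confluent_jet_col (h f : {poly R}) :
  injective alpha -> size h = N.+1 ->
  (forall i, ('X - (alpha i)%:P) ^+ beta i %| polyC_of h) ->
  invmx (confluent_mx beta alpha) *m jet_col beta alpha f =
    (map_mx (real_complex R) (poly_rV (f %% h)))^T.
Proof.
move=> alpha_inj size_h dvd_h; rewrite -(jet_col_modp _ _ dvd_h) jet_col_coef.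
  by rewrite mulKmx // confluent_mx_unit.
by rewrite -ltnS -size_h ltn_modpN0 // -size_poly_gt0 size_h.
Qed.

Lemma tr_jet_col (f : {poly R}) :
  (jet_col beta alpha f)^T = jet_row beta alpha f.
Proof. exact: tr_mxcol. Qed.

End ConfluentSystem.

(** * Polynomials under the integral and the defect of the form *)

Section PolynomialIntegral.
Variables (R : realType) (mu : {measure set (measurableTypeR R) -> \bar R}).
Variable I : set R.
Hypothesis mI : measurable (I : set (measurableTypeR R)).
Hypothesis moments :
  forall n : nat, mu.-integrable I (fun t : R => (t ^+ n)%:E).

Lemma integrable_horner (f : {poly R}) :
  mu.-integrable I (EFin \o (fun t : R => f.[t])).
Proof.
rewrite -(coefK f) poly_def; elim/big_ind: _ => [|f1 f2 int1 int2|k _].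
- under [X in integrable _ _ X]eq_fun => t do rewrite /= horner0.
  exact: integrable0.
- under [X in integrable _ _ X]eq_fun => t do rewrite /= hornerD EFinD.
  exact: integrableD.
under [X in integrable _ _ X]eq_fun => t do rewrite /= hornerZ hornerXn EFinM.
exact: integrableZl.
Qed.

Definition poly_int (f : {poly R}) : R := \int[mu]_(t in I) f.[t].

Lemma poly_intD : {morph poly_int : f g / f + g}.
Proof.
move=> f g; rewrite /poly_int -RintegralD //; last 2 first.
- exact: integrable_horner.
- exact: integrable_horner.
by apply: eq_Rintegral => t _; rewrite hornerD.
Qed.

Lemma poly_intZ (c : R) : {morph poly_int : f / c *: f >-> c * f}.
Proof.
move=> f; rewrite /poly_int -RintegralZl //; last exact: integrable_horner.
by apply: eq_Rintegral => t _; rewrite hornerZ.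
Qed.

Lemma poly_int_sum n (F : 'I_n -> {poly R}) :
  poly_int (\sum_i F i) = \sum_i poly_int (F i).
Proof.
by apply: (big_morph _ poly_intD); rewrite -(scale0r 0) poly_intZ mul0r.
Qed.

Variable form : {symmetric {poly R}}.

(** The defect is bilinear and [moment_defect_mx] is its Gram matrix on the
    monomials. *)
Lemma form_defect_coef N (f g : {poly R}) :
  (size f <= N)%N -> (size g <= N)%N ->
  form f g - poly_int (f * g) =
    (poly_rV f *m moment_defect_mx mu I form N *m (poly_rV g)^T) ord0 ord0.
Proof.
move=> size_f size_g.
rewrite [in LHS](poly_sum_coef_wide size_g) mulr_sumr linear_sumr poly_int_sum.
rewrite -sumrB mxE.
apply: eq_bigr => j _; rewrite linearZr_LR /= -scalerAr poly_intZ -mulrBr !mxE.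
rewrite mulrC; congr (_ * _).
rewrite [in LHS](poly_sum_coef_wide size_f) mulr_suml linear_sumlz poly_int_sum.
rewrite -sumrB.
apply: eq_bigr => i _; rewrite linearZl_LR -scalerAl poly_intZ -mulrBr !mxE.
congr (_ * (_ - _)); rewrite -exprD.
by apply: eq_Rintegral => t _; rewrite hornerXn.
Qed.

Variable h : {poly R}.
Hypothesis form_hl : forall f g : {poly R},
  form (h * f) g = density_int mu I h (fun t : R => f.[t] * g.[t]).
Hypothesis form_hr : forall f g : {poly R},
  form f (h * g) = density_int mu I h (fun t : R => f.[t] * g.[t]).

(** The factor h can be moved between the integrand and the measure, so the
    defect vanishes when one argument is a multiple of h; only the remainders
    of the two divisions survive. *)
Lemma form_defect_modp (f g : {poly R}) :
  form f g - poly_int (f * g) =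
    form (f %% h) (g %% h) - poly_int ((f %% h) * (g %% h)).
Proof.
have radl (q q' : {poly R}) : form (h * q) q' = poly_int (h * q * q').
  by rewrite form_hl; apply: eq_Rintegral => t _; rewrite !hornerM; ring.
have radr (q q' : {poly R}) : form q (h * q') = poly_int (q * (h * q')).
  by rewrite form_hr; apply: eq_Rintegral => t _; rewrite !hornerM; ring.
rewrite {1 2}(divp_eq f h) (mulrC _ h) linearDl /= mulrDl poly_intD radl.
rewrite opprD addrACA subrr add0r.
rewrite {1 2}(divp_eq g h) (mulrC _ h) linearDr /= mulrDr poly_intD radr.
by rewrite opprD addrACA subrr add0r.
Qed.

End PolynomialIntegral.

Theorem proposition1 (R : realType) (mu : probability (measurableTypeR R) R)
    (I : set R)
    (mI : measurable (I : set (measurableTypeR R)))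
    (infI : infinite_set I)
    (mu_on_I : mu (~` I) = 0%E)
    (mu_nontrivial : nontrivial_measure mu)
    (moments : forall n : nat, mu.-integrable I (fun t : R => (t ^+ n)%:E))
    (p : nat) (beta : 'I_p -> nat) (alpha : 'I_p -> R[i]) (h : {poly R})
    (h_monic : h \is monic)
    (h_size : size h = (\sum_(i < p) beta i).+1)
    (alpha_inj : injective alpha)
    (alpha_zeros :
       forall z : R[i], root (polyC_of h) z <-> exists i : 'I_p, z = alpha i)
    (beta_mult : forall i : 'I_p, beta i = mup (alpha i) (polyC_of h))
    (form : {symmetric {poly R}})
    (form_hl : forall f g : {poly R},
       form (h * f) g = density_int mu I h (fun t : R => f.[t] * g.[t]))
    (form_hr : forall f g : {poly R},
       form f (h * g) = density_int mu I h (fun t : R => f.[t] * g.[t])) :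
  let A := confluent_mx beta alpha in
  let S := moment_defect_mx mu I form (\sum_(i < p) beta i) in
  forall f g : {poly R},
    (form f g)%:C =
      (\int[mu]_(t in I) (f.[t] * g.[t]))%:C
      + (jet_row beta alpha f *m (invmx A)^T *m map_mx (real_complex R) S
         *m invmx A *m jet_col beta alpha g) ord0 ord0.
Proof.
move=> A S f g.
have h_neq0 : h != 0 by rewrite monic_neq0.
have dvd_h i : ('X - (alpha i)%:P) ^+ beta i %| polyC_of h.
  by rewrite -mup_geq ?map_poly_eq0 // beta_mult.
have size_mod (q : {poly R}) : (size (q %% h)%R <= \sum_(i < p) beta i)%N.
  by rewrite -ltnS -h_size ltn_modpN0.
rewrite -mulmxA -tr_jet_col -trmx_mul.
rewrite !(invmx_confluent_jet_col _ _ _ _ _ _ alpha_inj h_size dvd_h) trmxK.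
rewrite map_trmx -!map_mxM mxE -(form_defect_coef _ _ _ mI moments) //.
rewrite -(form_defect_modp _ _ _ mI moments _ _ form_hl form_hr).
have -> : \int[mu]_(t in I) (f.[t] * g.[t]) = poly_int R mu I (f * g).
  by apply: eq_Rintegral => t _; rewrite hornerM.
by rewrite -rmorphD addrC subrK.
Qed.
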